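(* Let $K\subsetneq 2^{[n]}$ be a proper simplicial complex such that $\mathrm{Vert}(K)=[n]$. Then $\Gamma=2^{[n]}\setminus K$ is a roughly weighted simple game with all weights strictly positive if and only if the canonical fan $Fan(\Gamma)$ of $\Gamma$ is pseudo-polytopal in the sense that it refines the normal fan of a convex polytope.
   Context: Notation: $[n]=\{1,\dots,n\}$. A simplicial complex $K\subseteq 2^{[n]}$ is a family of subsets with $\emptyset\in K$ that is closed under taking subsets; it is proper if $K\neq 2^{[n]}$. The condition $\mathrm{Vert}(K)=[n]$ means $\{i\}\in K$ for every $i\in[n]$. A simple game on $[n]$ is a family $\Gamma\subseteq 2^{[n]}$ with $[n]\in\Gamma$, $\emptyset\notin\Gamma$, that is closed under taking supersets; for proper $K$ the family $\Gamma=2^{[n]}\setminus K$ is a simple game, whose winning coalitions are the sets not in $K$. $\Gamma$ is roughly weighted (with strictly positive weights) if there exist strictly positive real numbers $w_1,\dots,w_n$ and a positive real number $q$ such that for every $X\subseteq[n]$, with $w(X)=\sum_{i\in X}w_i$: $w(X)>q$ implies $X\in\Gamma$, and $w(X)<q$ implies $X\in K$. The Alexander dual of $K$ is $K^\circ=\{A\subseteq[n] : [n]\setminus A\notin K\}$. The canonical fan $Fan(\Gamma)=Fan(K)$ lives in $H_0=\{x\in\mathbb{R}^n : x_1+\dots+x_n=0\}$. Put $\delta_i=e_i-\frac1n(e_1+\dots+e_n)$ and $\bar\delta_i=-\delta_i$ for $i\in[n]$, where $e_1,\dots,e_n$ is the standard basis of $\mathbb{R}^n$. The cones of $Fan(K)$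 are exactly the cones generated by $\{\delta_i : i\in A_1\}\cup\{\bar\delta_j : j\in A_2\}$ over all pairs $(A_1,A_2)$ with $A_1\in K$, $A_2\in K^\circ$, $A_1\cap A_2=\emptyset$. It is known that this is a complete simplicial fan in $H_0$. Normal fans are outer normal fans, with $H_0$ identified with its dual by the standard inner product. A fan $\mathcal F$ refines a fan $\mathcal N$ if every cone of $\mathcal F$ is contained in a cone of $\mathcal N$.
   Formalization: The convex polytope is required to be full-dimensional in H_0; otherwise a single point, whose normal fan is {H_0}, would be refined by every canonical fan and the equivalence would fail, e.g. for K generated by {1,2,3} and {4,5,6}. *)

(* Defs.v *)
From mathcomp Require Import all_boot all_order all_algebra.
From mathcomp Require Import boolp classical_sets functions cardinality reals.

Set Implicit Arguments.
Unset Strict Implicit.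
Unset Printing Implicit Defensive.

Import Order.TTheory GRing.Theory Num.Theory.

Local Open Scope ring_scope.

Section Combinatorics.
Local Open Scope set_scope.
Variable n : nat.
Implicit Types (K Gamma : {set {set 'I_n}}) (A B X : {set 'I_n}).

Definition simplicial_complex K : Prop :=
  finset.set0 \in K /\ (forall A B, A \subset B -> B \in K -> A \in K).

Definition proper_complex K : Prop := K <> [set: {set 'I_n}].

Definition all_vertices K : Prop := forall i : 'I_n, [set i] \in K.

Definition winning_coalitions K : {set {set 'I_n}} := ~: K.

Definition losing_coalitions Gamma : {set {set 'I_n}} := ~: Gamma.

Definition simple_game Gamma : Prop :=
  [/\ [set: 'I_n] \in Gamma,
      finset.set0 \notin Gamma
    & forall A B, A \subset B -> A \in Gamma -> B \in Gamma].

Definition roughly_weighted (R : realType) Gamma : Prop :=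
  exists (w : 'I_n -> R) (q : R),
    [/\ forall i, 0 < w i, 0 < q
      & forall X,
          (q < \sum_(i in X) w i -> X \in Gamma) /\
          (\sum_(i in X) w i < q -> X \in losing_coalitions Gamma)].

Definition alexander_dual K : {set {set 'I_n}} := [set A | ~: A \notin K].

End Combinatorics.

Section Geometry.
Local Open Scope classical_set_scope.
Variables (R : realType) (n : nat).
Local Notation V := 'rV[R]_n.
Implicit Types (P F : set V) (fan : set (set V)) (x y z : V).

Definition dot x y : R := \sum_i x 0 i * y 0 i.

Definition H0 : set V := [set x | \sum_i x 0 i = 0].

Definition convex_hull (S : set V) : set V :=
  [set x | exists (m : nat) (p : 'I_m -> V) (c : 'I_m -> R),
    [/\ forall k, S (p k), forall k, 0 <= c k, \sum_k c k = 1
      & x = \sum_k c k *: p k]].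

Definition affine_hull (S : set V) : set V :=
  [set x | exists (m : nat) (p : 'I_m -> V) (c : 'I_m -> R),
    [/\ forall k, S (p k), \sum_k c k = 1 & x = \sum_k c k *: p k]].

Definition convex_polytope P : Prop :=
  exists S : set V, [/\ finite_set S, S !=set0 & P = convex_hull S].

Definition exposed_face P y : set V :=
  [set x | P x /\ forall z, P z -> dot y z <= dot y x].

Definition normal_cone P F : set V :=
  [set y | H0 y /\ forall x, F x -> exposed_face P y x].

(* The nonempty faces of a polytope in H0, the polytope itself included, are
   exactly its exposed faces in the directions of H0. *)
Definition normal_fan P : set (set V) :=
  [set C | exists y, H0 y /\ C = normal_cone P (exposed_face P y)].

Definition refines fan fan' : Prop :=
  forall C, fan C -> exists D, fan' D /\ C `<=` D.

(* The polytope has to be full-dimensional in H0: this is what makes its outer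
   normal cones pointed, hence a fan in the same sense as the canonical fan.
   Otherwise a single point, with H0 as its only normal cone, would do for
   every family of cones in H0. *)
Definition pseudo_polytopal fan : Prop :=
  exists P, [/\ convex_polytope P, affine_hull P = H0
              & refines fan (normal_fan P)].

Definition delta (i : 'I_n) : V :=
  delta_mx 0 i - n%:R^-1 *: \sum_j delta_mx 0 j.

Definition bdelta (i : 'I_n) : V := - delta i.

Definition fan_cone (A1 A2 : {set 'I_n}) : set V :=
  [set x | exists c d : 'I_n -> R,
    [/\ forall i, 0 <= c i, forall j, 0 <= d j
      & x = \sum_(i in A1) c i *: delta i + \sum_(j in A2) d j *: bdelta j]].

Definition canonical_fan (Gamma : {set {set 'I_n}}) : set (set V) :=
  let K := losing_coalitions Gamma in
  [set C | exists A1 A2 : {set 'I_n},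
    [/\ A1 \in K, A2 \in alexander_dual K, A1 :&: A2 = finset.set0
      & C = fan_cone A1 A2]].

End Geometry.

(* Main.v *)
(* If w(A) <= q for A in K and w(A) >= q otherwise, the polytope is the slice
   sum x = q of the box 0 <= x <= w, translated into H_0. For A in K with
   A + i not in K it has the vertex equal to w on A, to q - w(A) at i and to 0
   elsewhere. This vertex maximizes the coordinates in A and minimizes those
   outside A + i, so the cone generated by the corresponding delta's and
   bar-delta's lies in its normal cone.
   Conversely, given a polytope P, let w_i be the width of P in direction i and
   q = - sum_i min_P x_i. The cone of (A, {}), A in K, is contained in a normal
   cone, so some v in P maximizes all coordinates in A at once, and sum v = 0
   gives w(A) <= q; for A not in K the cone of ({}, complement of A) gives
   w(A) >= q in the same way. *)
Require Import Defs.
From mathcomp Require Import all_boot all_order all_algebra.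
From mathcomp Require Import boolp classical_sets functions cardinality reals.
From mathcomp Require Import lra.

Set Implicit Arguments.
Unset Strict Implicit.
Unset Printing Implicit Defensive.

Import Order.TTheory GRing.Theory Num.Theory.

Local Open Scope ring_scope.

(** * Simplicial complexes, and how a chain of sets leaves them *)

Section Complexes.
Import fintype boot.finset.
Local Open Scope set_scope.
Variable n : nat.
Implicit Types (K : {set {set 'I_n}}) (A B C : {set 'I_n}) (i j : 'I_n).

Lemma full_notin_complex K :
  simplicial_complex K -> proper_complex K -> [set: 'I_n] \notin K.
Proof.
move=> [_ hK] hp; apply/negP => h; apply: hp.
by apply/setP => A; rewrite inE (hK A _ (finset.subsetT A) h).
Qed.

Lemma winning_coalitions_simple_game K :
  simplicial_complex K -> proper_complex K -> simple_game (winning_coalitions K).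
Proof.
move=> hK hp; split.
- by rewrite inE full_notin_complex.
- by rewrite inE negbK; case: hK.
- move=> A B AB; rewrite !inE; apply: contra; case: hK => _; exact.
Qed.

Lemma notin_complex_inhabited K A :
  simplicial_complex K -> A \notin K -> exists i, i \in A.
Proof.
by move=> [K0 _] AK; apply/set0Pn; apply: contraNneq AK => ->.
Qed.

(** A largest member [B] of [K] between [A] and [C] is a proper subset of [C], and adding to it any
    further element of [C] leaves [K]. *)
Lemma complex_crossing K A C :
    A \in K -> C \notin K -> A \subset C ->
  exists B i, [/\ A \subset B, i |: B \subset C, i \notin B,
                  B \in K & i |: B \notin K].
Proof.
move=> AK CK AC.
pose Q B := [&& A \subset B, B \subset C & B \in K].
have QA : Q A by rewrite /Q subxx AC AK.
case: (arg_maxnP (fun B : {set 'I_n} => #|B|) QA) => B /and3P[AB BC BK] Bmax.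
have /subsetPn[i iC iB] : ~~ (C \subset B).
  by apply: contra CK => CB; have /eqP -> : C == B by rewrite eqEsubset CB BC.
have iBC : i |: B \subset C by rewrite subUset sub1set iC BC.
exists B, i; split=> //; apply/negP => iBK.
have := Bmax (i |: B); rewrite /Q iBC iBK (subset_trans AB (subsetU1 _ _)) /=.
by move=> /(_ isT); rewrite cardsU1 iB add1n ltnn.
Qed.

End Complexes.

(** * Crossings compatible with a given order of the coordinates *)

Section Orders.
Import fintype boot.finset.
Local Open Scope set_scope.
Variables (R : realDomainType) (n : nat).
Implicit Types (K : {set {set 'I_n}}) (A B C : {set 'I_n}) (i j : 'I_n).

(* Completeness of the canonical fan: every [c] lies, up to a constant vector,
   in the cone of some pair [(B, ~: (i |: B))]. *)
Lemma ordered_crossing K (c : 'I_n -> R) :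
    simplicial_complex K -> [set: 'I_n] \notin K ->
  exists B i, [/\ i \notin B, B \in K, i |: B \notin K,
    forall j, j \in B -> c i <= c j & forall j, j \notin B -> c j <= c i].
Proof.
move=> hKc KT; have [_ hK] := hKc.
have [i0 _ i0min] : exists2 i0, i0 \in [set: 'I_n] & forall j, c i0 <= c j.
  have [k _] := notin_complex_inhabited hKc KT.
  by case: (@arg_minP _ _ _ k xpredT c isT) => i _ h; exists i => // j; apply: h.
(* Among the indices whose weak superlevel set is outside [K], [i] is taken with [c i] largest. *)
pose Q i := [set j | c i <= c j] \notin K.
have Qi0 : Q i0.
  by apply: contra KT; apply: hK; apply/subsetP => j _; rewrite inE i0min.
case: (arg_maxP c Qi0) => i Qi imax.
(* Otherwise a minimizer [l] of [c] on the strict superlevel set would satisfy [Q l] with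
   [c i < c l]. *)
have Ki : [set j | c i < c j] \in K.
  apply/negPn/negP => H.
  have [k] := notin_complex_inhabited hKc H.
  rewrite inE => ik.
  case: (@arg_minP _ _ _ k (fun j => c i < c j) c ik) => l il lmin.
  have : Q l.
    apply: contra H; apply: hK; apply/subsetP => j; rewrite !inE; exact: lmin.
  by move=> /imax li; have : c l <= c i := li; rewrite leNgt il.
have sub : [set j | c i < c j] \subset [set j | c i <= c j].
  by apply/subsetP => j; rewrite !inE; exact: ltW.
have [B [l [AB BC lB BK lBK]]] := complex_crossing Ki Qi sub.
have cl : c l = c i.
  apply/eqP; rewrite eq_le; apply/andP; split.
    rewrite leNgt; apply: contra lB => il.
    by apply: (subsetP AB); rewrite inE.
  by move: (subsetP BC l (setU11 _ _)); rewrite inE.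
exists B, l; split=> // j jB; rewrite cl.
  by move: (subsetP BC j (setU1r _ jB)); rewrite inE.
by rewrite leNgt; apply: contra jB => ij; apply: (subsetP AB); rewrite inE.
Qed.

End Orders.

(** * Convex and affine hulls, exposed faces, and a spanning criterion for [H0] *)

Section Hulls.
Local Open Scope classical_set_scope.
Variables (R : realType) (n : nat).
Local Notation V := 'rV[R]_n.
Implicit Types (P S : set V) (x y z : V).

Lemma dot_sumr y m (c : 'I_m -> R) (p : 'I_m -> V) :
  dot y (\sum_k c k *: p k) = \sum_k c k * dot y (p k).
Proof.
rewrite /dot (eq_bigr (fun i => \sum_k c k * (y 0 i * p k 0 i))).
  by rewrite exchange_big; apply: eq_bigr => k _; rewrite mulr_sumr.
move=> i _; rewrite summxE mulr_sumr; apply: eq_bigr => k _.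
by rewrite mxE mulrCA.
Qed.

Lemma dot_delta_mx j z : dot (delta_mx 0 j) z = z 0 j.
Proof.
rewrite /dot (bigD1 j) //= big1 => [|k /negPf kj].
  by rewrite mxE !eqxx mul1r addr0.
by rewrite mxE kj mul0r.
Qed.

Lemma sub_convex_hull S : S `<=` convex_hull S.
Proof.
move=> s Ss; exists 1%N, (fun=> s), (fun=> 1); split=> //.
  by rewrite big_ord1.
by rewrite big_ord1 scale1r.
Qed.

Lemma sub_affine_hull S : S `<=` affine_hull S.
Proof.
by move=> s Ss; exists 1%N, (fun=> s), (fun=> 1); rewrite !big_ord1 scale1r.
Qed.

Lemma dot_convex_hull_le S y b :
  (forall s, S s -> dot y s <= b) -> forall z, convex_hull S z -> dot y z <= b.
Proof.
move=> hS z [m [p [c [Sp c0 c1 ->]]]]; rewrite dot_sumr -[leRHS]mul1r -c1 mulr_suml.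
by apply: ler_sum => k _; apply: ler_wpM2l => //; apply: hS.
Qed.

Lemma dot_affine_hull_const S y b :
  (forall s, S s -> dot y s = b) -> forall z, affine_hull S z -> dot y z = b.
Proof.
move=> hS z [m [p [c [Sp c1 ->]]]]; rewrite dot_sumr -[RHS]mul1r -c1 mulr_suml.
by apply: eq_bigr => k _; rewrite hS.
Qed.

Lemma H0P x : H0 x <-> dot (const_mx 1) x = 0.
Proof.
rewrite /H0 /dot /=; under [in X in _ <-> X]eq_bigr do rewrite mxE mul1r.
by [].
Qed.

Lemma convex_hull_H0 S : S `<=` @H0 R n -> convex_hull S `<=` @H0 R n.
Proof.
move=> SH z [m [p [c [Sp _ c1 ->]]]]; apply/H0P.
by rewrite dot_sumr big1 // => k _; rewrite (H0P _).1 ?mulr0 //; apply/SH.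
Qed.

Lemma affine_hull_H0 S : S `<=` @H0 R n -> affine_hull S `<=` @H0 R n.
Proof.
move=> SH z /dot_affine_hull_const h; apply/H0P; apply: h => s /SH; exact: (H0P _).1.
Qed.

(** A linear functional on the hull of a finite set is maximal at one of the generating points. *)
Lemma exposed_face_neq0 P y : convex_polytope P -> exposed_face P y !=set0.
Proof.
move=> [S [/finite_seqP[s ->] [x0 /= x0s] ->]].
case: (@arg_maxP _ _ (seq_sub s) (SeqSub x0s) xpredT
        (fun t => dot y (val t)) isT) => x _ xmax.
exists (val x); split; first by apply: sub_convex_hull; exact: valP.
by apply: dot_convex_hull_le => t ts; exact: (xmax (SeqSub ts)).
Qed.

(* Adding the all-ones vector turns affine combinations in [H0] into linear
   ones, so it is enough that the shifted points span the whole space. *)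
Lemma H0_sub_affine_hull m (p : 'I_m -> V) (k0 : 'I_m) :
    (0 < n)%N -> (forall k, H0 (p k)) ->
    (forall y, (forall k l, dot y (p k) = dot y (p l)) ->
      forall i j, y 0 i = y 0 j) ->
  @H0 R n `<=` affine_hull (range p).
Proof.
move=> n0 pH hconst x xH.
have n0R : n%:R != 0 :> R by rewrite pnatr_eq0 -lt0n.
pose M : 'M[R]_(m, n) := \matrix_k (p k + const_mx 1).
have sum1 (u : V) : H0 u -> \sum_i (u + const_mx 1) 0 i = n%:R.
  move=> uH; under eq_bigr do rewrite !mxE.
  by rewrite big_split /= uH add0r sumr_const card_ord.
(* A kernel vector has the same product with every [p k], so it is constant by [hconst]; a row of
   [M] has coordinate sum [n], so the constant is 0. *)
have ker (y : 'cV[R]_n) : M *m y = 0 -> y = 0.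
  move=> My0.
  have yp k : dot y^T (p k) = - \sum_i y i 0.
    have /matrixP/(_ k 0) := My0; rewrite !mxE => e.
    apply/eqP; rewrite -addr_eq0 -[eqbRHS]e /dot -big_split /=; apply/eqP.
    by apply: eq_bigr => i _; rewrite !mxE mulrDl mul1r mulrC.
  have ceq i : y i 0 = y (Ordinal n0) 0.
    by have := hconst y^T _ i (Ordinal n0); rewrite !mxE; apply=> k l; rewrite !yp.
  have := My0 => /matrixP/(_ k0 0); rewrite !mxE.
  under eq_bigr => i _ do rewrite ceq !mxE.
  rewrite -mulr_suml => /eqP; rewrite mulf_eq0.
  have := sum1 _ (pH k0); under eq_bigr do rewrite !mxE.
  move=> ->; rewrite (negPf n0R) /= => /eqP c0.
  by apply/colP => i; rewrite ceq c0 mxE.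
(* The columns of the cokernel matrix lie in this kernel, so the rows of [M] span the whole
   space. *)
have /submxP[D xD] : ((x + const_mx 1)%R <= M)%MS.
  suff cok : cokermx M = 0 by rewrite submxE cok mulmx0.
  apply/matrixP => i j; have := ker (col j (cokermx M)).
  rewrite colE mulmxA mulmx_coker mul0mx => /(_ erefl)/matrixP/(_ i 0).
  by rewrite -colE !mxE.
have xE : x + const_mx 1 = \sum_k D 0 k *: (p k + const_mx 1).
  rewrite xD mulmx_sum_row; apply: eq_bigr => k _.
  by rewrite rowK.
(* All the shifted points, that of [x] included, have coordinate sum [n]. *)
have D1 : \sum_k D 0 k = 1.
  apply: (mulIf n0R); rewrite mul1r -[RHS](sum1 _ xH) xE mulr_suml.
  under [RHS]eq_bigr do rewrite summxE.
  rewrite exchange_big; apply: eq_bigr => k _ /=.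
  under eq_bigr do rewrite mxE.
  by rewrite -mulr_sumr sum1.
exists m, p, (D 0); split=> //.
apply: (addIr (const_mx 1)); rewrite xE.
under eq_bigr do rewrite scalerDr.
by rewrite big_split /= -scaler_suml D1 scale1r.
Qed.

End Hulls.

(** * Inner products with the cone generators, and weights read off from a polytope *)

Section CanonicalFan.
Local Open Scope classical_set_scope.
Variables (R : realType) (n : nat).
Local Notation V := 'rV[R]_n.
Local Notation H0 := (@H0 R n).
Local Notation delta := (@delta R n).
Local Notation bdelta := (@bdelta R n).
Implicit Types (P S : set V) (x y z : V) (K : {set {set 'I_n}}) (A : {set 'I_n}).

Lemma dotDl z : {morph (fun y => dot y z) : x y / x + y}.
Proof.
move=> x y; rewrite /dot -big_split; apply: eq_bigr => i _.
by rewrite mxE mulrDl.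
Qed.

Lemma dotZl z a y : dot (a *: y) z = a * dot y z.
Proof. by rewrite /dot mulr_sumr; apply: eq_bigr => i _; rewrite mxE mulrA. Qed.

Lemma dotNl z y : dot (- y) z = - dot y z.
Proof. by rewrite -scaleN1r dotZl mulN1r. Qed.

Lemma dot0l z : dot 0 z = 0.
Proof. by rewrite /dot big1 // => i _; rewrite mxE mul0r. Qed.

Lemma dotC y z : dot y z = dot z y.
Proof. by apply: eq_bigr => i _; rewrite mulrC. Qed.

Lemma dot_suml (I : Type) (r : seq I) (Q : pred I) (F : I -> V) z :
  dot (\sum_(i <- r | Q i) F i) z = \sum_(i <- r | Q i) dot (F i) z.
Proof. exact: (big_morph _ (dotDl z) (dot0l z)). Qed.

(** The all-ones part of [delta i] is orthogonal to [H0]. *)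
Lemma dot_delta i z : H0 z -> dot (delta i) z = z 0 i.
Proof.
move=> zH; rewrite /Defs.delta dotDl dotNl dotZl dot_suml dot_delta_mx.
under eq_bigr do rewrite dot_delta_mx.
by rewrite zH mulr0 subr0.
Qed.

Lemma delta_H0 i : H0 (delta i).
Proof.
have n0 : n%:R != 0 :> R by rewrite pnatr_eq0 -lt0n (leq_trans _ (ltn_ord i)).
apply/H0P; rewrite dotC /Defs.delta dotDl dotNl dotZl dot_suml dot_delta_mx mxE.
under eq_bigr do rewrite dot_delta_mx mxE.
by rewrite sumr_const card_ord mulVf // subrr.
Qed.

Lemma dot_fan_cone (A1 A2 : {set 'I_n}) (c d : 'I_n -> R) z : H0 z ->
  dot (\sum_(i in A1) c i *: delta i + \sum_(j in A2) d j *: bdelta j) z =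
  \sum_(i in A1) c i * z 0 i - \sum_(j in A2) d j * z 0 j.
Proof.
move=> zH; rewrite dotDl !dot_suml -sumrN; congr (_ + _); apply: eq_bigr => i _.
  by rewrite dotZl dot_delta.
by rewrite dotZl dotNl dot_delta // mulrN.
Qed.

Lemma fan_cone_H0 (A1 A2 : {set 'I_n}) : @fan_cone R n A1 A2 `<=` H0.
Proof.
move=> _ [c [d [_ _ ->]]]; apply/H0P; rewrite dotC dotDl !dot_suml !big1 ?addr0 //.
  by move=> i _; rewrite dotZl dotNl dotC (H0P _).1 ?oppr0 ?mulr0 //; exact: delta_H0.
by move=> i _; rewrite dotZl dotC (H0P _).1 ?mulr0 //; exact: delta_H0.
Qed.

Lemma delta_fan_cone (A1 A2 : {set 'I_n}) i : i \in A1 -> fan_cone A1 A2 (delta i).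
Proof.
move=> iA; exists (fun j => (j == i)%:R), (fun=> 0); split=> //.
rewrite [X in _ = _ + X]big1 ?addr0 => [|j _]; last by rewrite scale0r.
rewrite (bigD1 i) //= eqxx scale1r big1 ?addr0 // => j /andP[_ /negPf ->].
by rewrite scale0r.
Qed.

Lemma bdelta_fan_cone (A1 A2 : {set 'I_n}) j : j \in A2 -> fan_cone A1 A2 (bdelta j).
Proof.
move=> jA; exists (fun=> 0), (fun i => (i == j)%:R); split=> //.
rewrite big1 ?add0r => [|i _]; last by rewrite scale0r.
rewrite (bigD1 j) //= eqxx scale1r big1 ?addr0 // => i /andP[_ /negPf ->].
by rewrite scale0r.
Qed.

(** The cone lies in the normal cone of a single exposed face; any point of that face serves as [v],
    as testing the generators shows. *)
Lemma refines_common_vertex P K (A1 A2 : {set 'I_n}) :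
    convex_polytope P -> P `<=` H0 ->
    refines (@canonical_fan R n (winning_coalitions K)) (normal_fan P) ->
    A1 \in K -> A2 \in alexander_dual K -> (A1 :&: A2)%SET = finset.set0 ->
  exists v, [/\ P v, forall z i, P z -> i \in A1 -> z 0 i <= v 0 i
                   & forall z j, P z -> j \in A2 -> v 0 j <= z 0 j].
Proof.
move=> Pp PH ref A1K A2K A12.
have [|_ [[y [_ ->]] sub]] := ref (fan_cone A1 A2).
  by exists A1, A2; rewrite /losing_coalitions finset.setCK.
have [v yv] := exposed_face_neq0 y Pp.
exists v; split=> [|z i Pz iA|z j Pz jA]; first by case: yv.
- have [_ /(_ _ yv)[Pv /(_ z Pz)]] := sub _ (delta_fan_cone A2 iA).
  by rewrite !dot_delta //; exact: PH.
- have [_ /(_ _ yv)[Pv /(_ z Pz)]] := sub _ (bdelta_fan_cone A1 jA).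
  by rewrite !dotNl !dot_delta ?lerN2 //; exact: PH.
Qed.

Lemma pseudo_polytopal_roughly_weighted K :
    simplicial_complex K -> proper_complex K -> all_vertices K ->
    pseudo_polytopal (@canonical_fan R n (winning_coalitions K)) ->
  roughly_weighted R (winning_coalitions K).
Proof.
move=> hK hp hv [P [Pp aff ref]].
have PH : P `<=` H0 by rewrite -aff; exact: sub_affine_hull.
have TK := full_notin_complex hK hp.
have vert (A1 A2 : {set 'I_n}) := @refines_common_vertex P K A1 A2 Pp PH ref.
have /fin_all_exists[t ht] (i : 'I_n) :
    exists v, P v /\ forall z, P z -> z 0 i <= v 0 i.
  have [v [Pv vmax]] := exposed_face_neq0 (delta i) Pp.
  exists v; split=> // z Pz; have := vmax z Pz.
  by rewrite !dot_delta //; exact: PH.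
have /fin_all_exists[s hs] (i : 'I_n) :
    exists v, P v /\ forall z, P z -> v 0 i <= z 0 i.
  have [v [Pv vmax]] := exposed_face_neq0 (bdelta i) Pp.
  exists v; split=> // z Pz; have := vmax z Pz.
  by rewrite !dotNl !dot_delta ?lerN2 //; exact: PH.
pose w i := t i 0 i - s i 0 i; pose q := - \sum_i s i 0 i.
(* Zero width would make coordinate [i] constant on the affine hull [H0], but [delta i] and
   [delta j] differ there. Such a [j] exists because [[set i]] is in [K] and the full set is not. *)
have w0 i : 0 < w i.
  have st : s i 0 i <= t i 0 i by apply: (ht i).2; exact: (hs i).1.
  rewrite subr_gt0 lt_neqAle st andbT; apply/eqP => ste.
  have ci z : H0 z -> z 0 i = t i 0 i.
    rewrite -aff => zP; rewrite -dot_delta_mx.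
    apply: dot_affine_hull_const zP => x Px; rewrite dot_delta_mx; apply/eqP.
    by rewrite eq_le (ht i).2 // -ste (hs i).2.
  have [j ji] : exists j, j != i.
    apply/not_existsP => h; move: TK; suff -> : [set: 'I_n]%SET = [set i]%SET.
      by rewrite hv.
    apply/finset.setP => j; rewrite !inE; apply/esym/negPn/negP; exact: h.
  have := ci _ (delta_H0 j); have := ci _ (delta_H0 i).
  move=> <-; rewrite /Defs.delta !mxE !eqxx (eq_sym i j) (negPf ji) /=.
  by lra.
have sumID (A : {set 'I_n}) (f : 'I_n -> R) :
    \sum_i f i = \sum_(i in A) f i + \sum_(i | i \notin A) f i.
  exact: (bigID (mem A)).
have wK A : A \in K -> \sum_(i in A) w i <= q.
  move=> AK; have [|| v [Pv vA _]] := vert A finset.set0 AK.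
  - by rewrite inE finset.setC0.
  - by rewrite finset.setI0.
  have := PH _ Pv; rewrite /Defs.H0 /= /q !(sumID A) /w sumrB.
  have : \sum_(i in A) t i 0 i <= \sum_(i in A) v 0 i.
    by apply: ler_sum => i iA; apply: vA (ht i).1 iA.
  have : \sum_(i | i \notin A) s i 0 i <= \sum_(i | i \notin A) v 0 i.
    by apply: ler_sum => i _; exact: (hs i).2.
  lra.
have wNK A : A \notin K -> q <= \sum_(i in A) w i.
  move=> AK; have [||| v [Pv _ vA]] := vert finset.set0 (~: A)%SET.
  - by case: hK.
  - by rewrite inE finset.setCK.
  - by rewrite finset.set0I.
  have := PH _ Pv; rewrite /Defs.H0 /= /q !(sumID A) /w sumrB.
  have : \sum_(i in A) v 0 i <= \sum_(i in A) t i 0 i.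
    by apply: ler_sum => i _; exact: (ht i).2.
  have : \sum_(i | i \notin A) v 0 i <= \sum_(i | i \notin A) s i 0 i.
    by apply: ler_sum => i iA; apply: vA (hs i).1 _; rewrite finset.in_setC.
  lra.
exists w, q; split=> //.
  have [i _] := notin_complex_inhabited hK TK.
  by apply: lt_le_trans (w0 i) _; have := wK _ (hv i); rewrite finset.big_set1.
move=> X; rewrite /losing_coalitions /winning_coalitions !inE negbK; split.
  by apply: contraTN => /wK; rewrite -leNgt.
by apply: contraTT => /wNK; rewrite -leNgt.
Qed.

End CanonicalFan.

(** * The polytope cut from a box by weights and a quota *)

Section HypersimplexPolytope.
Local Open Scope classical_set_scope.
Variables (R : realType) (n : nat).
Local Notation V := 'rV[R]_n.
Local Notation H0 := (@H0 R n).
Implicit Types (x y z : V) (K : {set {set 'I_n}}) (A : {set 'I_n}).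

(* Taking the largest losing weight as the quota makes it smaller than the total
   weight; otherwise the slice below could degenerate to a point. *)
Lemma roughly_weighted_quota K :
    simplicial_complex K -> proper_complex K -> all_vertices K ->
    roughly_weighted R (winning_coalitions K) ->
  exists (w : 'I_n -> R) (q : R),
    [/\ forall i, 0 < w i, 0 < q, q < \sum_i w i,
        forall A, A \in K -> \sum_(i in A) w i <= q
      & forall A, A \notin K -> q <= \sum_(i in A) w i].
Proof.
move=> hK hp hv [w [q [w0 q0 wq]]].
have TK := full_notin_complex hK hp.
have [K0 Kdown] := hK.
have wK A : A \in K -> \sum_(i in A) w i <= q.
  by move=> AK; rewrite leNgt; apply: contraTN AK => /(wq A).1; rewrite inE.
have wNK A : A \notin K -> q <= \sum_(i in A) w i.
  by move=> AK; rewrite leNgt; apply: contra AK => /(wq A).2; rewrite !inE negbK.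
case: (arg_maxP (fun A : {set 'I_n} => \sum_(i in A) w i) K0) => B BK Bmax.
have [i _] := notin_complex_inhabited hK TK.
exists w, (\sum_(i in B) w i); split=> //.
- apply: lt_le_trans (Bmax _ (hv i)); by rewrite finset.big_set1.
(* [B] misses some [j], whose positive weight makes the inequality strict. *)
- have /fintype.subsetPn[j _ jB] : ~~ ([set: 'I_n]%SET \subset B).
    by apply: contra TK => /Kdown; apply.
  rewrite [ltRHS](bigID (mem B)) /= ltrDl (bigD1 j) //= ltr_wpDr //.
  by apply: sumr_ge0 => k _; exact: ltW.
- by move=> A AK; exact: le_trans (wK B BK) (wNK A AK).
Qed.

(** A pair [(B, i)] stands for the maximal cone of the fan given by [(B, ~: (i |: B))]. *)
Definition crossings K : {set {set 'I_n} * 'I_n} :=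
  [set p : {set 'I_n} * 'I_n | [&& p.2 \notin p.1, p.1 \in K & p.2 |: p.1 \notin K]]%SET.

Variables (w : 'I_n -> R) (q : R).

(* A vertex of the slice [\sum_i x_i = q] of the box [0 <= x <= w], translated
   into [H0]. *)
Definition slice_vertex (p : {set 'I_n} * 'I_n) : V :=
  \row_j (w j *+ (j \in p.1) + (q - \sum_(k in p.1) w k) *+ (j == p.2)
          - q / (\sum_k w k) * w j).

(** Indexed by ordinals, since [H0_sub_affine_hull] takes its points as the rows of a matrix. *)
Definition slice_vertices K : set V :=
  range (fun k : 'I_#|crossings K| => slice_vertex (enum_val k)).

Variable K : {set {set 'I_n}}.
Hypotheses (hK : simplicial_complex K) (TK : [set: 'I_n]%SET \notin K).
Hypotheses (w0 : forall i, 0 < w i) (q0 : 0 < q) (qW : q < \sum_i w i).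
Hypothesis wK : forall A, A \in K -> \sum_(i in A) w i <= q.
Hypothesis wNK : forall A, A \notin K -> q <= \sum_(i in A) w i.

Lemma slice_vertices_crossing p : p \in crossings K -> slice_vertices K (slice_vertex p).
Proof. by move=> pK; exists (enum_rank_in pK p) => //; rewrite enum_rankK_in. Qed.

Lemma total_weight_neq0 : \sum_i w i != 0.
Proof. by rewrite gt_eqF // (lt_trans q0). Qed.

(** Before the translation the coordinates sum to [q], and so do those of the subtracted multiple of
    [w]. *)
Lemma slice_vertex_H0 p : H0 (slice_vertex p).
Proof.
rewrite /Defs.H0 /=; under eq_bigr do rewrite mxE.
rewrite sumrB big_split /= -mulr_sumr divfK ?total_weight_neq0 //.
rewrite (eq_bigr (fun i => if i \in p.1 then w i else 0)) => [|i _]; last exact: mulrb.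
rewrite -big_mkcond /= [X in _ + X - _](bigD1 p.2) //= eqxx mulr1n.
rewrite [X in _ + (_ + X)]big1 => [|i /negPf -> //].
by rewrite addr0 addrCA subrr addr0 subrr.
Qed.

Lemma slice_vertex_mem p j : p \in crossings K -> j \in p.1 ->
  slice_vertex p 0 j = w j - q / (\sum_k w k) * w j.
Proof.
rewrite inE => /and3P[pi _ _] jp; rewrite mxE jp (_ : j == p.2 = false) ?addr0 //.
by apply: contraNF pi => /eqP <-.
Qed.

Lemma slice_vertex_notin p j : j \notin (p.2 |: p.1)%SET ->
  slice_vertex p 0 j = - (q / (\sum_k w k) * w j).
Proof.
by rewrite !inE negb_or mxE => /andP[/negPf -> /negPf ->]; rewrite !add0r.
Qed.

(** Only coordinate [p.2] can lie strictly between the bounds; there they amount to [wK] for [p.1]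
    and [wNK] for [p.2 |: p.1]. *)
Lemma slice_vertex_box p j : p \in crossings K ->
  - (q / (\sum_k w k) * w j) <= slice_vertex p 0 j
     <= w j - q / (\sum_k w k) * w j.
Proof.
move=> pK; have := pK; rewrite inE => /and3P[pi pA pNA].
have [jp|jp] := boolP (j \in p.1).
  by rewrite slice_vertex_mem // lexx andbT lerDr ltW.
have [->|ji] := eqVneq j p.2; last first.
  by rewrite slice_vertex_notin ?lexx ?lerDr ?ltW // !inE negb_or ji.
have := wK pA; have := wNK pNA; rewrite finset.big_setU1 //=.
rewrite mxE eqxx (negPf pi) mulr0n mulr1n; lra.
Qed.

Lemma slice_polytope_box z j : convex_hull (slice_vertices K) z ->
  - (q / (\sum_k w k) * w j) <= z 0 j <= w j - q / (\sum_k w k) * w j.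
Proof.
move=> zP; rewrite -[z 0 j]dot_delta_mx; apply/andP; split; last first.
  apply: dot_convex_hull_le zP => _ [k _ <-]; rewrite dot_delta_mx.
  by have /andP[] := slice_vertex_box j (enum_valP k).
rewrite lerNl -dotNl; apply: dot_convex_hull_le zP => _ [k _ <-].
rewrite dotNl dot_delta_mx lerNl.
by have /andP[] := slice_vertex_box j (enum_valP k).
Qed.

Lemma slice_polytope_H0 : convex_hull (slice_vertices K) `<=` H0.
Proof. by apply: convex_hull_H0 => _ [k _ <-]; exact: slice_vertex_H0. Qed.

Lemma exists_crossing : exists p, p \in crossings K.
Proof.
have [B [i [_ _ iB BK iBK]]] := complex_crossing hK.1 TK (finset.sub0set _).
by exists (B, i); rewrite inE; apply/and3P.
Qed.

Lemma slice_polytope_convex : convex_polytope (convex_hull (slice_vertices K)).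
Proof.
exists (slice_vertices K); split=> //.
  by apply: finite_image; exact: finite_finset.
have [p pK] := exists_crossing.
by exists (slice_vertex p); exact: slice_vertices_crossing.
Qed.

(* In the coordinates [y - y_i], where [(B, i)] is the crossing that [y]
   selects, [dot y v] is a sum of nonnegative terms. *)
Lemma slice_vertex_dot_ge0 y : exists2 p, p \in crossings K &
  0 <= dot y (slice_vertex p) /\
  (dot y (slice_vertex p) = 0 -> forall j, y 0 j = y 0 p.2).
Proof.
have [B [i [iB BK iBK yB yNB]]] := ordered_crossing (y 0) hK TK.
have pK : (B, i) \in crossings K by rewrite inE; apply/and3P.
exists (B, i) => //=.
have -> : dot y (slice_vertex (B, i)) =
    \sum_j (y 0 j - y 0 i) * slice_vertex (B, i) 0 j.
  under [RHS]eq_bigr do rewrite mulrBl.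
  by rewrite sumrB -mulr_sumr (slice_vertex_H0 (B, i)) mulr0 subr0.
(* As [q] lies strictly between 0 and the total weight, the vertex is strictly positive on [B] and
   strictly negative off [i |: B]; this settles the equality case. *)
have r0 j : 0 < q / (\sum_k w k) * w j.
  by rewrite mulr_gt0 // divr_gt0 // (lt_trans q0).
have r1 j : 0 < w j - q / (\sum_k w k) * w j.
  by rewrite subr_gt0 gtr_pMl // ltr_pdivrMr ?mul1r // (lt_trans q0).
have sgn j : 0 <= (y 0 j - y 0 i) * slice_vertex (B, i) 0 j
    /\ ((y 0 j - y 0 i) * slice_vertex (B, i) 0 j = 0 -> y 0 j = y 0 i).
  have [jB|jB] := boolP (j \in B).
    rewrite slice_vertex_mem //; split.
      by apply: mulr_ge0; [rewrite subr_ge0 yB | exact: ltW].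
    by move/eqP; rewrite mulf_eq0 (gt_eqF (r1 j)) orbF subr_eq0 => /eqP.
  have [->|ji] := eqVneq j i; first by rewrite subrr mul0r lexx.
  rewrite slice_vertex_notin ?inE ?negb_or ?ji // mulrN -mulNr opprB; split.
    by apply: mulr_ge0; [rewrite subr_ge0 yNB | exact: ltW].
  by move/eqP; rewrite mulf_eq0 (gt_eqF (r0 j)) orbF subr_eq0 => /eqP.
split; first by apply: sumr_ge0 => j _; exact: (sgn j).1.
by move=> /psumr_eq0P h j; apply: (sgn j).2; apply: h => // k _; exact: (sgn k).1.
Qed.

(** If [y] has the same product with all vertices, the crossings selected by [y] and [- y] force
    this product to be 0, so [y] is constant and the spanning criterion applies. *)
Lemma affine_hull_slice_polytope : affine_hull (convex_hull (slice_vertices K)) = H0.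
Proof.
apply/seteqP; split; first exact: (affine_hull_H0 slice_polytope_H0).
have [p pK] := exists_crossing.
have sub : affine_hull (slice_vertices K) `<=`
    affine_hull (convex_hull (slice_vertices K)).
  move=> x [m [u [c [uS c1 ->]]]]; exists m, u, c; split=> // k.
  exact: sub_convex_hull.
apply: subset_trans sub; apply: H0_sub_affine_hull.
- exact: enum_rank_in pK p.
- exact: leq_ltn_trans (leq0n _) (ltn_ord p.2).
- by move=> k; exact: slice_vertex_H0.
move=> y yconst.
have yeq p1 p2 : p1 \in crossings K -> p2 \in crossings K ->
    dot y (slice_vertex p1) = dot y (slice_vertex p2).
  move=> p1K p2K.
  by have := yconst (enum_rank_in p1K p1) (enum_rank_in p1K p2); rewrite !enum_rankK_in.
have [p1 p1K [ge1 eq1]] := slice_vertex_dot_ge0 y.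
have [p2 p2K []] := slice_vertex_dot_ge0 (- y).
rewrite dotNl oppr_ge0 (yeq _ _ p2K p1K) => le1 _ i j.
have /eq1 yp : dot y (slice_vertex p1) = 0 by apply/eqP; rewrite eq_le le1 ge1.
by rewrite !yp.
Qed.

(** A crossing between [A1] and [~: A2] gives a vertex [v] maximizing the coordinates in [A1] and
    minimizing those in [A2], hence maximizing every functional in the cone. *)
Lemma refines_slice_polytope :
  refines (@canonical_fan R n (winning_coalitions K))
    (normal_fan (convex_hull (slice_vertices K))).
Proof.
move=> _ [A1 [A2 [A1K A2K A12 ->]]].
rewrite /losing_coalitions /winning_coalitions finset.setCK in A1K.
have A2NK : (~: A2)%SET \notin K by move: A2K; rewrite !inE negbK.
have A1A2 : A1 \subset (~: A2)%SET.
  by rewrite -finset.disjoints_subset -finset.setI_eq0 A12.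
have [B [i [A1B BA2 iB BK iBK]]] := complex_crossing A1K A2NK A1A2.
have pK : (B, i) \in crossings K by rewrite inE; apply/and3P.
set P := convex_hull _; pose v := slice_vertex (B, i).
have vS : slice_vertices K v := slice_vertices_crossing pK.
have PH : P `<=` H0 := slice_polytope_H0.
have Pv : P v := sub_convex_hull vS.
have v1 z j : P z -> j \in A1 -> z 0 j <= v 0 j.
  move=> Pz jA; rewrite slice_vertex_mem ?(fintype.subsetP A1B) //.
  by have /andP[] := slice_polytope_box j Pz.
have v2 z j : P z -> j \in A2 -> v 0 j <= z 0 j.
  move=> Pz jA; rewrite slice_vertex_notin.
    by have /andP[] := slice_polytope_box j Pz.
  by apply: contraL jA => /(fintype.subsetP BA2); rewrite inE.
have vmax x : fan_cone A1 A2 x -> forall z, P z -> dot x z <= dot x v.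
  move=> [c [d [c0 d0 ->]]] z Pz; rewrite !dot_fan_cone; try exact: PH.
  apply: lerB; apply: ler_sum => j jA; apply: ler_wpM2l => //.
    exact: v1.
  exact: v2.
(* [y] lies in the relative interior of the cone, so that its exposed face has
   constant coordinates in [A1] and [A2]. *)
pose y : V := \sum_(j in A1) 1 *: delta R j + \sum_(j in A2) 1 *: bdelta R j.
have yF : fan_cone A1 A2 y by exists (fun=> 1), (fun=> 1).
exists (normal_cone P (exposed_face P y)); split.
  by exists y; split=> //; exact: fan_cone_H0 yF.
move=> x xF; split; first exact: fan_cone_H0 xF.
move=> z [Pz zmax]; split=> // z' Pz'; apply: le_trans (vmax x xF z' Pz') _.
have [zH vH] := (PH z Pz, PH v Pv).
(* Both sums have nonnegative terms, so all terms vanish: [z] agrees with [v] on [A1] and [A2], and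
   each [x] of the cone takes its maximum at [z] too. *)
have sum0 : \sum_(j in A1) (v 0 j - z 0 j) + \sum_(j in A2) (z 0 j - v 0 j) <= 0.
  have := zmax v Pv; rewrite /y !dot_fan_cone //.
  have mul1 (A : {set 'I_n}) (f : 'I_n -> R) : \sum_(j in A) 1 * f j = \sum_(j in A) f j.
    by apply: eq_bigr => j _; rewrite mul1r.
  rewrite !mul1 !sumrB; lra.
have n1 j : j \in A1 -> 0 <= v 0 j - z 0 j by move=> jA; rewrite subr_ge0 v1.
have n2 j : j \in A2 -> 0 <= z 0 j - v 0 j by move=> jA; rewrite subr_ge0 v2.
have s1 := sumr_ge0 (index_enum _) n1.
have s2 := sumr_ge0 (index_enum _) n2.
have /(psumr_eq0P n1) e1 : \sum_(j in A1) (v 0 j - z 0 j) = 0 by lra.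
have /(psumr_eq0P n2) e2 : \sum_(j in A2) (z 0 j - v 0 j) = 0 by lra.
have [c [d [_ _ ->]]] := xF; rewrite !dot_fan_cone // lerB //.
  by apply: ler_sum => j /e1/subr0_eq ->.
by apply: ler_sum => j /e2/subr0_eq ->.
Qed.

End HypersimplexPolytope.

Theorem theorem1p2 (R : realType) (n : nat) (K : {set {set 'I_n}})
  (hK : simplicial_complex K)
  (hproper : proper_complex K)
  (hvert : all_vertices K) :
  (simple_game (winning_coalitions K) /\
   roughly_weighted R (winning_coalitions K)) <->
  pseudo_polytopal (@canonical_fan R n (winning_coalitions K)).
Proof.
split=> [[_ rw]|pp]; last first.
  split; first exact: winning_coalitions_simple_game.
  exact: pseudo_polytopal_roughly_weighted pp.
have TK := full_notin_complex hK hproper.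
have [w [q [w0 q0 qW wK wNK]]] := roughly_weighted_quota hK hproper hvert rw.
exists (convex_hull (slice_vertices w q K)); split.
- exact: slice_polytope_convex.
- exact: affine_hull_slice_polytope.
- exact: refines_slice_polytope.
Qed.
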